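(* Let $I\subsetneq P=\Bbbk[x_1,\dots,x_n]$ be a non-zero proper homogeneous ideal, $H$ a homogeneous Pommaret basis of $I$ for some term order $\prec$, and $q=\deg H=\max_{h\in H}\deg h$. Then the Krull dimension $D$ of the algebra $A=P/I$ is $$D=\min\bigl\{i\mid\langle H,x_1,\dots,x_i\rangle_q=P_q\bigr\}.$$
   Context: $\Bbbk$ is a field; for a homogeneous ideal $J$, $J_q$ denotes its homogeneous component of degree $q$, and $P_q$ the space of homogeneous polynomials of degree $q$; $i$ ranges over $0,\dots,n$, and $\langle H,x_1,\dots,x_i\rangle$ is the ideal generated by $H$ and $x_1,\dots,x_i$. $\mathrm{le}_\prec f$ is the leading exponent of $f\ne0$. The class of $\mu\in\mathbb{N}_0^n$ is $\mathrm{cls}\,\mu=\min\{j\mid\mu_j\ne0\}$, with $\mathrm{cls}\,0=n$; the Pommaret cone of $\mu$ is $C_P(\mu)=\{\mu+\rho\mid\rho\in\mathbb{N}_0^n,\ \rho_j=0\text{ for all }j>\mathrm{cls}\,\mu\}$. A Pommaret basis of $I$ for $\prec$ is a finite set $H\subset I\setminus\{0\}$ with pairwise distinct leading exponents such that $\mathrm{le}_\prec I=\{\mathrm{le}_\prec f\mid0\ne f\in I\}$ is the disjoint union of the cones $C_P(\mathrm{le}_\prec h)$, $h\in H$; it is homogeneous if all its elements are. *)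

(* Defs.v *)
From HB Require Import structures.
From mathcomp Require Import all_boot all_order all_algebra ring_quotient.
From mathcomp Require Import finmap mpoly.

Set Implicit Arguments.
Unset Strict Implicit.
Unset Printing Implicit Defensive.

Import GRing.Theory.
Local Open Scope ring_scope.

Section CommutativeAlgebra.
Variable R : comNzRingType.

(* Strictly increasing chain p_0 < p_1 < ... < p_d of prime ideals. *)
Definition prime_chain (d : nat) (p : 'I_d.+1 -> prime_idealr R) : Prop :=
  forall i j : 'I_d.+1, (i < j)%N ->
    {subset p i <= p j} /\ (exists2 x, x \in p j & x \notin p i).

Definition is_krull_dim (d : nat) : Prop :=
  (exists p : 'I_d.+1 -> prime_idealr R, prime_chain p) /\
  (forall (e : nat) (p : 'I_e.+1 -> prime_idealr R),
     prime_chain p -> (e <= d)%N).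

(* A list of pairs (coefficient, generator), rather than a coefficient function
   on generators, so that repetitions are harmless. *)
Definition ideal_gen (S : R -> Prop) (f : R) : Prop :=
  exists s : seq (R * R),
    (forall ag, ag \in s -> S ag.2) /\ f = \sum_(ag <- s) ag.1 * ag.2.

End CommutativeAlgebra.

Definition is_minimum (P : nat -> Prop) (d : nat) : Prop :=
  P d /\ forall i, P i -> (d <= i)%N.

Section Monomials.
Variable n : nat.
Implicit Types (le : rel 'X_{1..n}) (mu nu : 'X_{1..n}).

Definition term_order le : Prop :=
  [/\ total le, antisymmetric le, transitive le,
      forall mu, le 0%MM mu &
      forall rho mu nu, le mu nu -> le (mu + rho)%MM (nu + rho)%MM].

(* Variables are numbered from 0 in 'I_n and from 1 in the definition of the
   class, hence the shift; the class of 0%MM is n. *)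
Definition cls mu : nat := \big[minn/n]_(j < n | mu j != 0%N) j.+1.

Definition pommaret_cone mu nu : Prop :=
  exists2 rho : 'X_{1..n},
    (forall j : 'I_n, (cls mu < j.+1)%N -> rho j = 0%N) & nu = (mu + rho)%MM.

End Monomials.

Section Polynomials.
Variables (n : nat) (k : fieldType).
Local Notation P := {mpoly k[n]}.
Implicit Types (le : rel 'X_{1..n}) (f h : P) (I : idealr P) (H : {fset P}).

(* Leading exponent for an arbitrary term order; mlead is tied to degrevlex.
   0%MM is the least exponent, so it is a neutral start value (and the junk
   value at f = 0). *)
Definition lexp le f : 'X_{1..n} :=
  \big[(fun mu nu => if le mu nu then nu else mu)/0%MM]_(mu <- msupp f) mu.

Definition homogeneous_ideal I : Prop :=
  forall f d, f \in I -> pihomog mdeg d f \in I.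

Definition pommaret_basis le I H : Prop :=
  [/\ (forall h, h \in H -> h \in I /\ h != 0),
      {in H &, injective (lexp le)},
      (forall mu, (exists f, [/\ f \in I, f != 0 & mu = lexp le f]) <->
                  (exists2 h, h \in H & pommaret_cone (lexp le h) mu)) &
      {in H &, forall h h', h != h' ->
         forall mu, ~ (pommaret_cone (lexp le h) mu /\
                       pommaret_cone (lexp le h') mu)}].

Definition homogeneous_set H : Prop := forall h, h \in H -> h \is homog mdeg.

Definition mdegree f : nat := (msize f).-1.

Definition fset_degree H : nat := \max_(h <- H) mdegree h.

Definition hcomponent (J : P -> Prop) (q : nat) (f : P) : Prop :=
  J f /\ f \is q.-homog.

Definition gens_with_vars H (i : nat) (g : P) : Prop :=
  g \in H \/ exists2 j : 'I_n, (j < i)%N & g = 'X_j.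

End Polynomials.

(* Main.v *)
(* Write N for the set of leading exponents of I, and let D be the least i such
   that <H, x_1, ..., x_i> contains P_q.

   Upper bound: rewriting degree-q monomials in x_{i+1}, ..., x_n shows, when
   <H, x_1, ..., x_i>_q = P_q, that A is spanned, compatibly with degrees, by
   the monomials of degree < q in x_{i+1}, ..., x_n with coefficients in
   k[x_1, ..., x_i]. Picking a_j in p_j \ p_{j-1} in a chain of e + 1 primes
   yields e algebraically independent elements, so counting monomials gives
   e <= i.

   Lower bound: if I met k[x_1, ..., x_D] nontrivially, N would contain a
   monomial in x_1, ..., x_D; since only variables up to the class are
   multiplicative, N would then contain every monomial of degree q in
   x_D, ..., x_n, and D - 1 would satisfy the condition as well. Hence A is a
   finite extension of k[x_1, ..., x_D], and the chain
   0 < (x_1) < ... < (x_1, ..., x_D) lifts to A by going up. *)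

Require Import Defs.
From HB Require Import structures.
From mathcomp Require Import all_boot all_order all_algebra ring_quotient.
From mathcomp Require Import finmap mpoly.
From mathcomp Require Import boolp classical_sets.

Set Implicit Arguments.
Unset Strict Implicit.
Unset Printing Implicit Defensive.

Import GRing.Theory.
Local Open Scope ring_scope.

(** * Prime ideals: existence by Zorn's lemma, and independence along a chain *)

Section CommutativeRings.
Variable R : comNzRingType.

(** An ideal maximal among those that contain [J] and miss the multiplicative set [S] is prime. *)
Lemma prime_ideal_avoiding (J S : R -> Prop) :
    J 0 -> (forall x y, J x -> J y -> J (x + y)) ->
    (forall a x, J x -> J (a * x)) ->
    S 1 -> (forall x y, S x -> S y -> S (x * y)) ->
    (forall x, J x -> ~ S x) ->
  exists p : prime_idealr R,
    (forall x, J x -> x \in p) /\ (forall x, x \in p -> ~ S x).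
Proof.
move=> J0 JD JM S1 SM JS.
pose ideal (K : R -> Prop) := [/\ K 0, forall x y, K x -> K y -> K (x + y),
  forall a x, K x -> K (a * x) & forall x, K x -> ~ S x].
(* Zorn's lemma also asks for the union of the empty chain. Stating the condition on the union of
   [X] and [J] covers this case: the empty set then stands for [J]. *)
pose P (X : set R) := ideal (fun x => X x \/ J x).
have [F FP Ftot|A [[A0 AD AM AS] Amax]] := @Zorn_bigcup R P.
  split; first by right.
  - move=> x y [[X FX Xx]|Jx] [[Y FY Yy]|Jy].
    + have [XY|YX] := Ftot _ _ FX FY.
      * have [_ D _ _] := FP _ FY.
        by case: (D x y (or_introl (XY _ Xx)) (or_introl Yy)) => ?;
          [left; exists Y|right].
      * have [_ D _ _] := FP _ FX.
        by case: (D x y (or_introl Xx) (or_introl (YX _ Yy))) => ?;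
          [left; exists X|right].
    + have [_ D _ _] := FP _ FX.
      by case: (D x y (or_introl Xx) (or_intror Jy)) => ?;
        [left; exists X|right].
    + have [_ D _ _] := FP _ FY.
      by case: (D x y (or_intror Jx) (or_introl Yy)) => ?;
        [left; exists Y|right].
    + by right; apply: JD.
  - move=> a x [[X FX Xx]|Jx]; last by right; apply: JM.
    have [_ _ M _] := FP _ FX.
    by case: (M a x (or_introl Xx)) => ?; [left; exists X|right].
  - move=> x [[X FX Xx]|Jx]; last exact: JS.
    by have [_ _ _ D] := FP _ FX; apply: D; left.
pose K x := A x \/ J x.
have maxK c : ~ K c -> exists2 s, S s & exists r, K (s - r * c).
  move=> nKc; apply: contrapT => noS.
  (* [B] is the ideal [K + (c)]; if it missed [S], it would contradict the maximality of [A]. *)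
  pose B x := exists r, K (x - r * c).
  have KB x : K x -> B x by move=> Kx; exists 0; rewrite mul0r subr0.
  apply: (Amax B).
    split=> [|BA]; first by move=> x Ax; apply: KB; left.
    apply: nKc; left; apply: BA; exists 1; rewrite mul1r subrr; exact: A0.
  have BJ x : B x \/ J x -> B x by case=> // Jx; apply: KB; right.
  split; first by right.
  - move=> x y /BJ[r Kx] /BJ[s Ky]; left; exists (r + s).
    by rewrite mulrDl opprD addrACA; apply: AD.
  - move=> a x /BJ[r Kx]; left; exists (a * r).
    by rewrite -mulrA -mulrBr; apply: AM.
  - by move=> x /BJ Bx Sx; apply: noS; exists x.
pose Kb x : bool := `[< K x >].
have KbP x : reflect (K x) (x \in Kb) by apply: asboolP.
have Kid : idealr_closed Kb.
  split; first exact/KbP; first by apply/KbP => /AS; apply.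
  by move=> a x y /KbP Kx /KbP Ky; apply/KbP; apply: AD => //; apply: AM.
have Kpr : prime_idealr_closed Kb.
  move=> u v /KbP Kuv; apply/orP.
  have [|nu] := pselect (K u); first by move=> /KbP; left.
  have [|nv] := pselect (K v); first by move=> /KbP; right.
  have [s Ss [r Kr]] := maxK _ nu; have [t St [w Kw]] := maxK _ nv.
  case: (AS (s * t)); last exact: SM.
  (* Each of [s - r * u], [t - w * v] and [u * v] lies in [K], so the element [s * t] of [S] would
     lie in [K] too. *)
  have -> : s * t = t * (s - r * u) + (r * u * (t - w * v) + r * w * (u * v)).
    rewrite !mulrBr; have -> : r * w * (u * v) = r * u * (w * v).
      by rewrite mulrACA.
    by rewrite subrK [t * (r * u)]mulrC subrK mulrC.
  by apply: (AD); [apply: (AM)|apply: (AD); apply: (AM)].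
pose m1 := isIdealr.Build R Kb Kid.
pose m2 := isPrimeIdealrClosed.Build R Kb Kpr.
pose p : prime_idealr R := HB.pack Kb m1 m2.
exists p; split=> x; first by move=> Jx; apply/KbP; right.
by move/KbP; apply: AS.
Qed.

(* Reading a relation at the lowest power of [f j], cancelling that power in
   [p j] and reducing modulo [p j.+1] eliminates [f j]. *)
Lemma prime_chain_independent (e : nat) (p : nat -> prime_idealr R)
    (f : nat -> R) (T : finType) (w : T -> nat -> nat) (c : T -> R) (j : nat)
    (X : pred T) :
    (forall l, (l < e)%N -> {subset p l <= p l.+1}) ->
    (forall l, (l < e)%N -> f l \in p l.+1) ->
    (forall l, (l < e)%N -> f l \notin p l) ->
    (forall t, c t \in p e -> c t = 0) -> (j <= e)%N ->
    (forall t u, X t -> X u ->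
       (forall l, (j <= l < e)%N -> w t l = w u l) -> t = u) ->
    \sum_(t | X t) c t * \prod_(j <= l < e) f l ^+ w t l \in p j ->
  forall t, X t -> c t = 0.
Proof.
move=> psub fin fnotin ce.
have [d] := ubnP (e - j)%N; elim: d j X => // d IHd j X dj je Xinj Xp t Xt.
apply/eqP; apply: contraT => ct.
have [ej|] := leqP e j.
  have Ej : j = e by apply/eqP; rewrite eqn_leq je.
  case/negP: ct; apply/eqP/ce; rewrite -Ej.
  suff <- : \sum_(t | X t) c t * \prod_(j <= l < e) f l ^+ w t l = c t by [].
  rewrite (big_pred1 t) ?big_geq ?mulr1 // => u; apply/idP/eqP => [Xu|-> //].
  apply: Xinj => // l /andP[jl le]; move: (leq_ltn_trans jl le).
  by rewrite ltnNge ej.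
move=> ltje.
pose Y := [pred u | X u && (c u != 0)].
have Yt : Y t by rewrite /= Xt.
pose t0 := [arg min_(u < t | Y u) w u j].
have [Yt0 t0min] : Y t0 /\ forall u, Y u -> (w t0 j <= w u j)%N.
  by rewrite /t0; case: arg_minnP.
set s := w t0 j in t0min.
have fjX r : f j ^+ r \notin p j.
  elim: r => [|r IHr]; first by rewrite expr0 idealr1.
  by rewrite exprS prime_idealrM negb_or fnotin.
pose g u := \prod_(j.+1 <= l < e) f l ^+ w u l.
have Yp : \sum_(u | Y u) c u * (f j ^+ (w u j - s) * g u) \in p j.
  have : f j ^+ s * \sum_(u | Y u) c u * (f j ^+ (w u j - s) * g u) \in p j.
    suff -> : f j ^+ s * (\sum_(u | Y u) c u * (f j ^+ (w u j - s) * g u)) =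
      \sum_(t | X t) c t * \prod_(j <= l < e) f l ^+ w t l by [].
    rewrite mulr_sumr [RHS](bigID (fun u => c u != 0)) /=.
    rewrite [X in _ = _ + X]big1 ?addr0.
      apply: eq_bigr => u Yu; rewrite big_ltn // mulrCA; congr (_ * _).
      by rewrite mulrA -exprD subnKC ?t0min.
    by move=> u /andP[_ /negbNE /eqP->]; rewrite mul0r.
  by rewrite prime_idealrM (negPf (fjX s)).
(* Terms whose exponent at [j] exceeds [s] still contain a factor [f j], which lies in [p j.+1]. *)
have Y'p : \sum_(u | Y u && (w u j == s)) c u * g u \in p j.+1.
  have := psub _ ltje _ Yp.
  rewrite (bigID (fun u => w u j == s)) /= rpredDr.
    suff -> : \sum_(u | Y u && (w u j == s)) c u * (f j ^+ (w u j - s) * g u) =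
      \sum_(u | Y u && (w u j == s)) c u * g u by [].
    by apply: eq_bigr => u /andP[_ /eqP->]; rewrite subnn expr0 mul1r.
  apply: rpred_sum => u /andP[Yu ws]; apply: idealMr.
  have : (0 < w u j - s)%N by rewrite subn_gt0 ltn_neqAle eq_sym ws t0min.
  by case: (w u j - s)%N => // r _; rewrite exprSr [_ * g u]mulrC !idealMr ?fin.
(* With the exponent at [j] frozen to [s], the remaining terms are told apart by their later
   exponents. *)
have Yinj u v : [pred u | Y u && (w u j == s)] u -> 
    [pred u | Y u && (w u j == s)] v ->
    (forall l, (j < l < e)%N -> w u l = w v l) -> u = v.
  move=> /= /andP[/andP[Xu _] /eqP ws] /andP[/andP[Xv _] /eqP ws'] E.
  apply: Xinj => // l /andP[]; rewrite leq_eqVlt => /orP[/eqP<- _|jl le].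
    by rewrite ws.
  by apply: E; rewrite jl.
have := IHd j.+1 _ _ ltje Yinj Y'p t0.
rewrite /= eqxx andbT => c0; have /andP[_ /eqP] := Yt0; case.
apply: c0 => //; rewrite -ltnS; apply: leq_ltn_trans dj.
by rewrite subnS prednK ?subn_gt0.
Qed.

End CommutativeRings.

(** A linear system with more unknowns than equations: the coefficient matrix has a non-zero left
    kernel. *)
Lemma nontrivial_relation (F : fieldType) (S T : finType) (a : S -> T -> F) :
    (#|T| < #|S|)%N ->
  exists2 c : S -> F, (exists s, c s != 0) &
    forall t, \sum_s c s * a s t = 0.
Proof.
move=> ltTS; pose A := \matrix_(i < #|S|, j < #|T|) a (enum_val i) (enum_val j).
have /rowV0Pn[v /sub_kermxP vA v0] : kermx A != 0.
  rewrite -mxrank_eq0 mxrank_ker subn_eq0 -ltnNge.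
  exact: leq_ltn_trans (rank_leq_col A) ltTS.
exists (fun s => v 0 (enum_rank s)).
  have /existsP[i vi] : [exists i, v 0 i != 0].
    apply: contraNT v0; rewrite negb_exists => /forallP v0.
    by apply/eqP/rowP => i; rewrite mxE; apply/eqP/negbNE.
  by exists (enum_val i); rewrite enum_valK.
move=> t; have := congr1 (fun M : 'rV_ _ => M 0 (enum_rank t)) vA.
rewrite !mxE => vAt; rewrite -[RHS]vAt.
rewrite (reindex _ (onW_bij _ (@enum_val_bij S))) /=.
by apply: eq_bigr => i _; rewrite enum_valK mxE enum_rankK.
Qed.

(** * Leading exponents for an arbitrary term order *)

Section LeadingExponents.
Variables (n : nat) (k : fieldType) (le : rel 'X_{1..n}).
Hypothesis le_order : term_order le.
Implicit Types (f g : {mpoly k[n]}) (mu nu rho : 'X_{1..n}).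

Lemma lexpP f : f != 0 ->
  lexp le f \in msupp f /\ forall mu, mu \in msupp f -> le mu (lexp le f).
Proof.
case: le_order => le_total le_anti le_trans le0 _.
rewrite -msupp_eq0 /lexp; elim: (msupp f : seq _) => [//|mu s IHs] _.
rewrite big_cons; have [->|/IHs {IHs}[Ms max_s]] := eqVneq s [::].
  rewrite big_nil; split=> [|nu]; rewrite mem_seq1.
    by case: ifP => // mu0; apply/eqP/le_anti; rewrite mu0 le0.
  by move/eqP->; case: ifP => //; have := le_total mu mu; rewrite orbb.
set M := \big[_/_]_(_ <- s) _ in Ms max_s *.
split=> [|nu]; first by case: ifP; rewrite inE ?eqxx // Ms orbT.
rewrite inE => /predU1P[->|/max_s nuM]; first case: ifP => // /negP.
  by have := le_total mu mu; rewrite orbb.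
case: ifP => // /negP/negP/negPf muM; apply: le_trans nuM _.
by have := le_total M mu; rewrite muM orbF.
Qed.

Lemma lexp_unique f mu : mu \in msupp f ->
  (forall nu, nu \in msupp f -> le nu mu) -> lexp le f = mu.
Proof.
case: le_order => _ le_anti _ _ _ fmu max_mu.
have [|fl max_l] := @lexpP f.
  by apply: contraTneq fmu => ->; rewrite msupp0.
by apply: le_anti; rewrite max_l ?max_mu.
Qed.

Lemma lexpMX f rho : f != 0 -> lexp le (f * 'X_[rho]) = (lexp le f + rho)%MM.
Proof.
case: le_order => _ _ _ _ leD /lexpP[fl max_l].
have supp nu : (nu \in msupp (f * 'X_[rho])) =
    (nu \in [seq (rho + m)%MM | m <- msupp f]) by apply/perm_mem/msuppMX.
apply: lexp_unique => [|nu]; rewrite supp.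
  by rewrite addmC map_f.
by case/mapP => m fm ->; rewrite addmC leD ?max_l.
Qed.

(* A homogeneous component has finitely many monomials, so cancelling leading
   terms terminates for every term order. *)
Lemma homog_span (J : {mpoly k[n]} -> Prop) (d : nat) :
    J 0 -> (forall f g, J f -> J g -> J (f + g)) ->
    (forall a f, J f -> J (a *: f)) ->
    (forall mu, mdeg mu = d ->
       exists g, [/\ J g, g != 0, g \is d.-homog & lexp le g = mu]) ->
  forall f, f \is d.-homog -> J f.
Proof.
case: (le_order) => le_total le_anti le_trans _ _ J0 JD JZ Jle f.
(* The leading exponent of [f] is itself counted here, so cancelling it strictly lowers the
   number. *)
pose below f := #|[pred nu : 'X_{1..n < d.+1} | le nu (lexp le f)]|.
have [m] := ubnP (below f); elim: m f => // m IHm f fm fd.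
have [->//|f0] := eqVneq f 0; have [fl max_f] := lexpP f0.
have dl := dhomog_mf fd fl.
have [g [Jg g0 gd gl]] := Jle _ dl; have [gg max_g] := lexpP g0.
rewrite gl in gg max_g; set l := lexp le f in fl max_f dl gl gg max_g.
pose a := f@_l / g@_l.
have -> : f = (f - a *: g) + a *: g by rewrite subrK.
apply: (JD); last exact: JZ.
have hd : f - a *: g \is d.-homog by rewrite rpredB ?rpredZ.
have [->//|h0] := eqVneq (f - a *: g) 0; have [hl _] := lexpP h0.
apply: IHm => //; set l' := lexp le (f - a *: g) in hl *.
have lel : le l' l.
  by have /(_ _ hl) := @msuppB_le _ _ f (a *: g); rewrite mem_cat
    => /orP[/max_f|/msuppZ_le/max_g].
have nel : l' != l.
  apply: contraTneq hl => ->; rewrite mcoeff_msupp negbK mcoeffB mcoeffZ.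
  by rewrite /a divfK ?subrr // -mcoeff_msupp.
have l_lt : (mdeg l < d.+1)%N by rewrite dl.
rewrite -ltnS; apply: leq_trans fm; rewrite ltnS; apply: proper_card.
apply/properP; split.
  by apply/fintype.subsetP => nu; rewrite !inE => /le_trans; apply.
exists (BMultinom l_lt); rewrite !inE /=.
  by have := le_total l l; rewrite orbb.
by apply: contra nel => lel'; apply/eqP/le_anti; rewrite lel.
Qed.

End LeadingExponents.

(** * Combinatorics of a set of exponents covered by Pommaret cones *)

Section PommaretCones.
Variable n : nat.
Implicit Types (mu nu rho : 'X_{1..n}).

Lemma cls_le mu (j : 'I_n) : mu j != 0%N -> (cls mu <= j.+1)%N.
Proof.
move=> muj; rewrite /cls; have := mem_index_enum j.
elim: (index_enum _) => // i s IHs; rewrite inE big_cons.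
move=> /predU1P[<-|/IHs sj]; first by rewrite muj geq_minl.
by case: ifP => // _; apply: leq_trans sj; apply: geq_minr.
Qed.

(* For [d <= l] some pure power of [x_l] lies in [N]: a generator of degree at
   most [q] whose cone contains [nu0 + q.+1 x_l] must have [x_l] as a
   multiplicative variable. *)
Lemma pommaret_monomial_mem (N E : 'X_{1..n} -> Prop) (q d : nat) nu0 mu :
    (forall nu rho, N nu -> N (nu + rho)%MM) ->
    (forall nu, N nu <-> exists2 ga, E ga & pommaret_cone ga nu) ->
    (forall ga, E ga -> (mdeg ga <= q)%N) ->
    N nu0 -> (forall j : 'I_n, (d < j)%N -> nu0 j = 0%N) ->
    (0 < q)%N -> mdeg mu = q -> (forall j : 'I_n, (j < d)%N -> mu j = 0%N) ->
  N mu.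
Proof.
move=> Nadd NE Eq Nnu0 nu0d q0 muq mud.
have mono (ga : 'X_{1..n}) (i : 'I_n) : (ga i <= mdeg ga)%N.
  by rewrite mdegE (bigD1 i) //= leq_addr.
have NEE ga : E ga -> N ga.
  move=> Ega; apply/NE; exists ga => //; exists 0%MM => [j _|].
    by rewrite mnm0E.
  by rewrite addm0.
have Nle ga nu : N ga -> (forall j : 'I_n, ga j <= nu j)%N -> N nu.
  by move=> Nga /mnm_lepP h; rewrite -(submK h) addmC; apply: Nadd.
have [i0 mui0] : exists i, mu i != 0%N.
  apply/existsP; apply: contraLR q0; rewrite negb_exists => /forallP mu0.
  rewrite -leqNgt -muq mdegE leqn0 big1 // => i _; apply/eqP/negbNE/mu0.
pose l := [arg min_(i < i0 | mu i != 0%N) (i : nat)].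
have [mul lmin] : mu l != 0%N /\ forall i, mu i != 0%N -> (l <= i)%N.
  by rewrite /l; case: arg_minnP.
have dl : (d <= l)%N by rewrite leqNgt; apply: contra mul => /mud->.
have mu_lt (j : 'I_n) : (j < l)%N -> mu j = 0%N.
  by move=> jl; apply/eqP; apply: contraTT jl => /lmin; rewrite -leqNgt.
have [s Ns] : exists s, N (U_(l) *+ s)%MM.
  have /NE[ga Ega [rho rho0 Erho]] := Nadd _ (U_(l) *+ q.+1)%MM Nnu0.
  have gaE j : (nu0 j + (l == j) * q.+1 = ga j + rho j)%N.
    by have := congr1 (fun m : 'X_{1..n} => m j) Erho; rewrite !mnmDE mulmnE mnm1E.
  (* A variable of [ga] before [x_l] would make [x_l] non-multiplicative; then [ga l] would be at
     least [q.+1], beyond the degree bound. *)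
  have ga_lt (j : 'I_n) : (j < l)%N -> ga j = 0%N.
    move=> jl; apply/eqP; apply: contraTT (leqnn q) => gaj.
    have rhol : rho l = 0%N by apply: rho0; apply: leq_ltn_trans (cls_le gaj) _.
    rewrite -ltnNge; apply: leq_trans (Eq _ Ega); apply: leq_trans (mono ga l).
    by have := gaE l; rewrite eqxx mul1n rhol addn0 => <-; rewrite leq_addl.
  exists (ga l); suff <- : ga = (U_(l) *+ ga l)%MM by apply: NEE.
  apply/mnmP => j; rewrite mulmnE mnm1E; case: eqVneq => [<-|lj]; first by rewrite mul1n.
  rewrite mul0n; have [|jl|/val_inj E'] := ltngtP j l; first exact: ga_lt.
    apply/eqP; have := gaE j; rewrite (negPf lj) mul0n addn0.
    rewrite nu0d ?(leq_ltn_trans dl) // => /esym/eqP.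
    by rewrite addn_eq0 => /andP[].
  by rewrite E' eqxx in lj.
(* The generator [ga] whose cone contains [mu + s x_l] turns out to divide [mu]; only the exponent
   at [l] is in doubt. *)
have /NE[ga Ega [rho rho0 Erho]] := Nadd _ mu Ns.
have gaE j : ((l == j) * s + mu j = ga j + rho j)%N.
  by have := congr1 (fun m : 'X_{1..n} => m j) Erho; rewrite !mnmDE mulmnE mnm1E.
have ga_ne j : l != j -> (ga j <= mu j)%N.
  by move=> lj; have := gaE j; rewrite (negPf lj) mul0n add0n => ->; rewrite leq_addr.
apply: Nle (NEE _ Ega) _ => j; have [lj|] := eqVneq l j; last exact: ga_ne.
rewrite -{j}lj; have [->//|gal] := eqVneq (ga l) 0%N.
(* If [x_l] divides [ga], the variables after [x_l] are non-multiplicative, so [ga] and [mu] agree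
   away from [l]. The bound [mdeg ga <= q = mdeg mu] then settles the exponent at [l]. *)
have gaj j : l != j -> ga j = mu j.
  move=> lj; have := ga_ne _ lj; have [jl|jl|/val_inj E'] := ltngtP j l.
  - by rewrite mu_lt // leqn0 => /eqP.
  - move=> _; have := gaE j; rewrite (negPf lj) mul0n add0n => ->.
    by rewrite rho0 ?addn0 // (leq_ltn_trans (cls_le gal)).
  - by rewrite E' eqxx in lj.
have := Eq _ Ega; rewrite -muq !mdegE (bigD1 l) //= [leqRHS](bigD1 l) //=.
rewrite [in leqLHS](eq_bigr mu) ?leq_add2r // => j jl.
by apply: gaj; rewrite eq_sym.
Qed.

End PommaretCones.

(** * Splitting a monomial into its first [i] variables and the others *)

Section VariableSplitting.
Variables (n i : nat).
Implicit Types mu nu : 'X_{1..n}.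

Definition mhead mu : 'X_{1..n} :=
  [multinom if (j < i)%N then mu j else 0%N | j < n].
Definition mtail mu : 'X_{1..n} :=
  [multinom if (j < i)%N then 0%N else mu j | j < n].

Lemma mhead_tail mu : (mhead mu + mtail mu)%MM = mu.
Proof. by apply/mnmP => j; rewrite mnmDE !mnmE; case: ifP; rewrite ?addn0. Qed.

Lemma mtailD mu nu : mtail (mu + nu) = (mtail mu + mtail nu)%MM.
Proof. by apply/mnmP => j; rewrite mnmDE !mnmE; case: ifP. Qed.

Lemma mtail_le mu : (mtail mu <= mu)%MM.
Proof. by apply/mnm_lepP => j; rewrite mnmE; case: ifP. Qed.

Lemma mtail_deg_lt mu (j : 'I_n) :
  (j < i)%N -> mu j != 0%N -> (mdeg (mtail mu) < mdeg mu)%N.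
Proof.
move=> ji muj; rewrite -{2}[mu]mhead_tail mdegD -[ltnLHS]add0n ltn_add2r.
by rewrite mdegE (bigD1 j) //= mnmE ji addn_gt0 lt0n muj.
Qed.

Lemma submonomial_of_degree mu q : (q <= mdeg mu)%N ->
  exists2 nu, (nu <= mu)%MM & mdeg nu = q.
Proof.
have [m] := ubnP (mdeg mu - q); elim: m mu => // m IHm mu mum qmu.
have [<-|neq] := eqVneq (mdeg mu) q; first by exists mu => //; apply: lepm_refl.
have ltq : (q < mdeg mu)%N by rewrite ltn_neqAle eq_sym neq.
have [j muj] : exists j, mu j != 0%N.
  apply/existsP; apply: contraTT ltq; rewrite negb_exists => /forallP mu0.
  by rewrite -leqNgt mdegE big1 // => j _; apply/eqP/negbNE/mu0.
have jmu : (U_(j) <= mu)%MM by rewrite lep1mP.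
have dmu : mdeg mu = (mdeg (mu - U_(j))%MM).+1.
  by rewrite -{1}(submK jmu) mdegD mdeg1 addn1.
case: (IHm (mu - U_(j))%MM) => [||nu le_nu <-].
- by rewrite -ltnS; apply: leq_trans mum; rewrite ltnS ltn_sub2r // dmu.
- by rewrite -ltnS -dmu.
exists nu => //; apply: lepm_trans le_nu _; exact: lem_subr.
Qed.

End VariableSplitting.

(** * Rewriting modulo the ideal so that tails have degree below [q] *)

Section Reduction.
Variables (n : nat) (k : fieldType) (I : idealr {mpoly k[n]}).
Implicit Types (f g : {mpoly k[n]}) (M : 'X_{1..n} -> Prop).

Definition reduces_to M f : Prop :=
  exists2 g, f - g \in I & forall nu, nu \in msupp g -> M nu.

Lemma reduces_to_supp M f :
  (forall mu, mu \in msupp f -> reduces_to M 'X_[mu]) -> reduces_to M f.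
Proof.
move=> Mf; rewrite [f]mpolyE.
suff: forall s : seq 'X_{1..n}, {subset s <= msupp f} ->
    reduces_to M (\sum_(mu <- s) f@_mu *: 'X_[mu]) by apply.
elim=> [_|mu s IHs sub].
  by exists 0 => [|nu]; rewrite ?big_nil ?subrr ?rpred0 ?msupp0.
have [g Ig Mg] := Mf mu (sub _ (mem_head _ _)).
have [|h Ih Mh] := IHs.
  by move=> nu s_nu; apply: sub; rewrite inE s_nu orbT.
exists (f@_mu *: g + h) => [|nu /msuppD_le].
  rewrite big_cons opprD addrACA rpredD // -scalerBr -mul_mpolyC.
  exact: idealMr.
by rewrite mem_cat => /orP[/msuppZ_le/Mg|/Mh].
Qed.

Lemma reduces_to_trans M f g : f - g \in I -> reduces_to M g -> reduces_to M f.
Proof.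
move=> Ifg [h Igh Mh]; exists h => //.
by rewrite -[f](subrK g) -addrA rpredD.
Qed.

Variables (H : {fset {mpoly k[n]}}) (q i : nat).
Hypotheses (I_homog : homogeneous_ideal I) (HI : forall h, h \in H -> h \in I).
Hypothesis cover : forall f, f \is q.-homog -> ideal_gen (gens_with_vars H i) f.

(** In an expression of the monomial through the generators, the multiples of elements of [H] vanish
    modulo [I]. What remains consists of multiples of the first [i] variables, whose tails are
    shorter. *)
Lemma reduces_to_head mu : mdeg mu = q ->
  reduces_to (fun nu => mdeg nu = q /\ (mdeg (mtail i nu) < q)%N) 'X_[mu].
Proof.
move=> muq; have [s [sP sE]] : ideal_gen (gens_with_vars H i) ('X_[mu] : {mpoly k[n]}).
  by apply: cover; rewrite dhomogX; apply/eqP.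
have [g Ig Mg] : reduces_to (fun nu => exists2 j : 'I_n, (j < i)%N & nu j != 0%N)
    'X_[mu].
  rewrite {}sE; elim: s sP => [_|[a h] s IHs sP].
    by exists 0 => [|nu]; rewrite ?big_nil ?subrr ?rpred0 ?msupp0.
  have [|g Ig Mg] := IHs.
    by move=> ag s_ag; apply: sP; rewrite inE s_ag orbT.
  rewrite big_cons /=; case: (sP (a, h) (mem_head _ _)) => /= [Hh|[j ji ->]].
    by exists g => //; rewrite -addrA rpredD // idealMr ?HI.
  exists (a * 'X_j + g) => [|nu /msuppD_le]; first by rewrite opprD addrACA subrr add0r.
  rewrite mem_cat => /orP[|/Mg //].
  rewrite (perm_mem (msuppMX _ _)) => /mapP[m _ ->]; exists j => //.
  by rewrite mnmDE mnm1E eqxx.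
(* As [I] is homogeneous, passing to the component of degree [q] preserves the congruence. *)
exists (pihomog mdeg q g) => [|nu nu_g].
  have := I_homog q Ig; rewrite raddfB /= pihomog_dE //.
  by rewrite dhomogX; apply/eqP.
have nuq : mdeg nu = q by apply: dhomog_mf nu_g; apply: pihomogP.
split=> //; have [j ji nuj] : exists2 j : 'I_n, (j < i)%N & nu j != 0%N.
  apply: Mg; move: nu_g; rewrite pihomogE => /msupp_sum_le.
  case/flattenP => t /mapP[m]; rewrite mem_filter => /andP[_ gm] ->.
  by move/msuppZ_le; rewrite msuppX mem_seq1 => /eqP->.
by rewrite -nuq; apply: mtail_deg_lt ji nuj.
Qed.

(** While the tail of a monomial has degree at least [q], a factor of degree [q] of this tail is
    rewritten by [reduces_to_head]. The total degree stays the same and the tail degree drops. *)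
Lemma reduces_to_bounded_tail f d :
    (forall mu, mu \in msupp f -> (mdeg mu <= d)%N) ->
  reduces_to (fun nu => (mdeg nu <= d)%N /\ (mdeg (mtail i nu) < q)%N) f.
Proof.
move=> fd; apply: reduces_to_supp => mu /fd {fd}.
have [t] := ubnP (mdeg (mtail i mu)); elim: t mu => // t IHt mu mut mud.
have [tq|qt] := ltnP (mdeg (mtail i mu)) q.
  exists 'X_[mu] => [|nu]; first by rewrite subrr rpred0.
  by rewrite msuppX mem_seq1 => /eqP->.
have [u le_u uq] := submonomial_of_degree qt.
have u_mu : (u <= mu)%MM by apply: lepm_trans le_u (mtail_le _ _).
have tu : mtail i u = u.
  apply/mnmP => j; rewrite mnmE; case: ifP => // ji.
  by have := mnm_lepP le_u j; rewrite mnmE ji leqn0 => /eqP.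
have [g Ig Mg] := reduces_to_head uq.
apply: (@reduces_to_trans _ _ (g * 'X_[mu - u])).
  by rewrite -{1}(submK u_mu) addmC mpolyXD -mulrBl mulrC idealMr.
apply: reduces_to_supp => nu.
rewrite (perm_mem (msuppMX _ _)) => /mapP[m /Mg[mq mtq] ->].
have dmu : mdeg mu = (mdeg (mu - u)%MM + q)%N by rewrite -uq -mdegD submK.
apply: IHt; last by rewrite mdegD mq -dmu.
rewrite mtailD mdegD -ltnS; apply: leq_trans mut; rewrite ltnS.
by rewrite -[in ltnRHS](submK u_mu) mtailD mdegD tu uq ltn_add2l.
Qed.

End Reduction.

(** * Upper bound for the Krull dimension, by counting monomials *)

Section KrullUpperBound.
Variables (n : nat) (k : fieldType) (I : idealr {mpoly k[n]}).
Local Notation A := {ideal_quot I}.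
Local Notation pi := (\pi_{ideal_quot I}%qT).

Lemma quot_pi_eq0 (f : {mpoly k[n]}) : (pi f == 0 :> A) = (f \in I).
Proof. by rewrite -[f in RHS]subr0 Quotient.idealrBE rmorph0. Qed.

Lemma quot_const_eq0 (c : k) : pi c%:MP = 0 -> c = 0.
Proof.
move/eqP; rewrite quot_pi_eq0 => Ic; apply/eqP; apply: contraFT (idealr1 I) => c0.
suff <- : c^-1%:MP * c%:MP = 1 :> {mpoly k[n]} by apply: idealMr.
by rewrite -mpolyCM mulVf.
Qed.

Lemma prime_idealr_const (p : prime_idealr A) (c : k) :
  pi c%:MP \in p -> pi c%:MP = 0.
Proof.
move=> pc; have [->|c0] := eqVneq c 0; first by rewrite mpolyC0 rmorph0.
suff : 1 \in p by rewrite idealr1.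
suff <- : pi c^-1%:MP * pi c%:MP = 1 :> A by apply: idealMr.
by rewrite -rmorphM -mpolyCM mulVf // rmorph1.
Qed.

Lemma msupp_deg_prod (e : nat) (F : nat -> {mpoly k[n]}) (C : nat)
    (t : nat -> nat) (m : nat) :
    (forall l, (l < e)%N -> (msize (F l) <= C.+1)%N) ->
    (forall l, (l < e)%N -> (t l <= m)%N) ->
  forall mu, mu \in msupp (\prod_(0 <= l < e) F l ^+ t l) ->
    (mdeg mu <= e * (m * C))%N.
Proof.
pose bd d (f : {mpoly k[n]}) := forall mu, mu \in msupp f -> (mdeg mu <= d)%N.
have bd1 : bd 0%N 1.
  by move=> mu; rewrite msupp1 mem_seq1 => /eqP->; rewrite mdeg0.
have bdM a b f g : bd a f -> bd b g -> bd (a + b)%N (f * g).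
  move=> fa gb mu /msuppM_le/allpairsP[[m1 m2] /= [/fa h1 /gb h2 ->]].
  by rewrite mdegD leq_add.
have bdX a f r : bd a f -> bd (r * a)%N (f ^+ r).
  by move=> fa; elim: r => [|r IHr]; rewrite ?expr0 // exprS mulSn; apply: bdM.
elim: e => [|e IHe] FC tm; first by rewrite big_geq // mul0n.
rewrite big_nat_recr //= mulSn addnC; apply: bdM.
  by apply: IHe => l le; [apply: FC|apply: tm]; apply: ltnW.
move=> mu h; suff : (mdeg mu <= t e * C)%N.
  by move/leq_trans; apply; rewrite leq_mul2r tm ?orbT.
apply: bdX h => nu /msize_mdeg_lt nu_lt; rewrite -ltnS.
by apply: leq_trans nu_lt _; apply: FC.
Qed.

Lemma expn_eventually_gt (e i K C : nat) : (i < e)%N -> exists m,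
  ((e * (m * C)).+1 ^ i * K < m.+1 ^ e)%N.
Proof.
(* The left side is at most [m.+1 ^ i * B ^ i * K], which is [m.+1 ^ i * m] for this [m], hence
   below [m.+1 ^ i.+1]. *)
move=> ie; pose B := (e * C).+1; exists (B ^ i * K)%N; set m := (B ^ i * K)%N.
have expi a b : (a <= b)%N -> (a ^ i <= b ^ i)%N.
  by move=> ab; case: (i) => // i'; rewrite leq_exp2r.
have mB : ((e * (m * C)).+1 <= m.+1 * B)%N.
  rewrite /B mulnS mulSn [(e * (m * C))%N]mulnCA.
  by rewrite addSn ltnS addnA leq_addl.
apply: (@leq_ltn_trans (m.+1 ^ i * m)%N).
  by rewrite {3}/m [leqRHS]mulnA leq_mul2r -expnMn expi ?orbT.
apply: (@leq_trans (m.+1 ^ i.+1)); last by rewrite leq_pexp2l.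
by rewrite expnSr ltn_pmul2l // expn_gt0.
Qed.

Variables (H : {fset {mpoly k[n]}}) (q i : nat).
Hypotheses (I_homog : homogeneous_ideal I) (HI : forall h, h \in H -> h \in I).
Hypothesis cover : forall f, f \is q.-homog -> ideal_gen (gens_with_vars H i) f.
Hypothesis i_le_n : (i <= n)%N.

(* The residue classes of degree at most [d] are spanned by O(d^i) monomials,
   whereas a chain of length [e] provides [e] algebraically independent
   elements. *)
Lemma krull_dim_le (e : nat) (p : 'I_e.+1 -> prime_idealr A) :
  prime_chain p -> (e <= i)%N.
Proof.
move=> chain; rewrite leqNgt; apply/negP => ie.
pose p' l := p (inord l).
have chainS l : (l < e)%N ->
    {subset p' l <= p' l.+1} /\ (exists2 x, x \in p' l.+1 & x \notin p' l).
  by move=> le; apply: chain; rewrite !inordK // ltnS ltnW.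
have /boolp.choice[f fP] : forall l, exists x, (l < e)%N ->
    x \in p' l.+1 /\ x \notin p' l.
  move=> l; have [le|el] := ltnP l e; last by exists 0.
  by have [_ [x x1 x2]] := chainS _ le; exists x.
pose F l := repr (f l); have piF l : pi (F l) = f l by apply: reprK.
pose C := \max_(l < e) msize (F l).
have FC l : (l < e)%N -> (msize (F l) <= C.+1)%N.
  by move=> le; apply: leqW; apply: (leq_bigmax (Ordinal le)).
pose K := #|{: 'X_{1..n < q}}|.
have [m mP] := expn_eventually_gt K C ie; set d := (e * (m * C))%N in mP.
pose S := {ffun 'I_e -> 'I_m.+1}.
pose T := ({ffun 'I_i -> 'I_d.+1} * 'X_{1..n < q})%type.
pose w (t : S) (l : nat) : nat := if insub l is Some j then t j : nat else 0%N.
have w_le t l : (l < e)%N -> (w t l <= m)%N.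
  by move=> le; rewrite /w insubT /= -ltnS.
pose G t := \prod_(0 <= l < e) F l ^+ w t l.
have /boolp.choice[g gP] : forall t, exists g, G t - g \in I /\
    forall nu, nu \in msupp g -> (mdeg nu <= d)%N /\ (mdeg (mtail i nu) < q)%N.
  move=> t.
  have [|g Ig gM] := @reduces_to_bounded_tail _ _ _ _ _ _ I_homog HI cover (G t) d.
    by apply: msupp_deg_prod FC _ => l; apply: w_le.
  by exists g.
(* The entries of [tau.2] at the first [i] variables are overwritten. Thus [mon] need not be
   injective, but it reaches all monomials that can occur in some [g t], which bounds their
   number. *)
pose mon (tau : T) : 'X_{1..n} := [multinom
  if insub (j : nat) is Some j' then tau.1 j' : nat else tau.2 j | j < n].
have monP nu : (mdeg nu <= d)%N /\ (mdeg (mtail i nu) < q)%N ->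
    exists tau, mon tau = nu.
  move=> [nud nuq].
  exists ([ffun j => inord (nu (widen_ord i_le_n j))], BMultinom nuq).
  apply/mnmP => j; rewrite mnmE /=; case: insubP => [j' _ j'j|].
    have -> : j = widen_ord i_le_n j' by apply: val_inj.
    rewrite ffunE inordK // ltnS; apply: leq_trans nud.
    by rewrite mdegE (bigD1 (widen_ord i_le_n j')) //= leq_addr.
  by rewrite mnmE => /negPf->.
have [|c [s cs0] cP] := @nontrivial_relation k S T (fun s tau => (g s)@_(mon tau)).
  by rewrite card_prod !card_ffun !card_ord.
have g0 : \sum_s c s *: g s = 0.
  apply/mpolyP => nu; rewrite mcoeff0 raddf_sum /=.
  have [/monP[tau <-]|nM] :=
      pselect ((mdeg nu <= d)%N /\ (mdeg (mtail i nu) < q)%N).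
    by rewrite -[RHS](cP tau); apply: eq_bigr => t _; rewrite mcoeffZ.
  rewrite big1 // => t _; rewrite mcoeffZ memN_msupp_eq0 ?mulr0 //.
  by apply/negP => /(gP t).2.
have IG : \sum_s c s *: G s \in I.
  have -> : \sum_s c s *: G s = \sum_s c s *: (G s - g s).
    by under [RHS]eq_bigr do rewrite scalerBr; rewrite sumrB g0 subr0.
  by apply: rpred_sum => t _; rewrite -mul_mpolyC idealMr // (gP t).1.
(* In [A] the linear relation among the reduced forms becomes a polynomial relation among the [f l],
   with constant coefficients. *)
have rel : \sum_(t : S) pi (c t)%:MP * \prod_(0 <= l < e) f l ^+ w t l \in p' 0%N.
  suff -> : \sum_(t : S) pi (c t)%:MP * \prod_(0 <= l < e) f l ^+ w t l = 0 :> A.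
    exact: rpred0.
  move: IG; rewrite -quot_pi_eq0 rmorph_sum => /eqP E; rewrite -[RHS]E.
  apply: eq_bigr => t _; rewrite -mul_mpolyC rmorphM rmorph_prod; congr (_ * _).
  by apply: eq_bigr => l _; rewrite rmorphXn /= piF.
have c0 := @prime_chain_independent A e p' f S w (fun t => pi (c t)%:MP) 0 xpredT.
case/negP: cs0; apply/eqP/quot_const_eq0; apply: c0 => //.
- by move=> l /chainS[].
- by move=> l /fP[].
- by move=> l /fP[].
- by move=> t; apply: prime_idealr_const.
- move=> t u _ _ E; apply/ffunP => j; apply: val_inj.
  by have := E j (ltn_ord j); rewrite /w valK.
Qed.

End KrullUpperBound.

(** * Setting some of the variables to zero *)

Section VariableKilling.
Variables (n : nat) (k : fieldType).
Implicit Types (P Q : pred 'I_n) (f g : {mpoly k[n]}).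

Definition msupported P (mu : 'X_{1..n}) : bool :=
  [forall j, (mu j != 0%N) ==> P j].

Lemma msupported_mnm1 P j : msupported P U_(j) = P j.
Proof.
apply/forallP/idP => [/(_ j)|Pj m]; first by rewrite mnm1E eqxx.
by rewrite mnm1E; case: (eqVneq j m) => [<-|//]; rewrite Pj implybT.
Qed.

(** As a substitution this is a ring morphism. The polynomial ring in the variables selected by [P]
    is handled as its set of fixed points. *)
Definition keep_vars P f : {mpoly k[n]} :=
  f \mPo [tuple if P j then 'X_j else 0 | j < n].

HB.instance Definition _ P := GRing.RMorphism.copy (keep_vars P)
  (comp_mpoly [tuple if P j then 'X_j else 0 | j < n]).

Lemma keep_varsX P mu :
  keep_vars P 'X_[mu] = if msupported P mu then 'X_[mu] else 0.
Proof.
rewrite /keep_vars comp_mpolyX; case: (boolP (msupported P mu)) => [/forallP Pmu|].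
  rewrite mpolyXE_id; apply: eq_bigr => j _; rewrite tnth_mktuple.
  have := Pmu j; case: eqVneq => [->|_ /= ->//]; by rewrite !expr0.
rewrite negb_forall => /existsP[j]; rewrite negb_imply => /andP[muj nPj].
by rewrite (bigD1 j) //= tnth_mktuple (negPf nPj) expr0n (negPf muj) mul0r.
Qed.

Lemma keep_varsZ P c f : keep_vars P (c *: f) = c *: keep_vars P f.
Proof. exact: comp_mpolyZ. Qed.

Lemma mcoeff_keep_vars P f mu :
  (keep_vars P f)@_mu = if msupported P mu then f@_mu else 0.
Proof.
rewrite [f in LHS]mpolyE rmorph_sum /= raddf_sum /=.
transitivity (\sum_(nu <- msupp f)
    if msupported P mu then (f@_nu *: 'X_[nu])@_mu else 0).
  apply: eq_bigr => nu _; rewrite keep_varsZ keep_varsX.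
  rewrite !mcoeffZ mcoeffX; case: eqVneq => [->|nu_mu].
    by case: ifP; rewrite ?mcoeffX ?eqxx ?mcoeff0 ?mulr0.
  by case: ifP; rewrite ?mcoeffX ?(negPf nu_mu) ?mcoeff0 ?mulr0; case: ifP.
case: ifP => _; last by rewrite big1.
by rewrite -raddf_sum -mpolyE.
Qed.

Lemma keep_vars_sub P Q f : {subset Q <= P} ->
  keep_vars Q (keep_vars P f) = keep_vars Q f.
Proof.
move=> QP; apply/mpolyP => mu; rewrite !mcoeff_keep_vars.
case: ifP => // /forallP Qmu; suff -> : msupported P mu by [].
by apply/forallP => j; apply/implyP => muj; apply/QP/(implyP (Qmu j)).
Qed.

Lemma keep_vars_idP P f :
  keep_vars P f = f -> forall mu, mu \in msupp f -> msupported P mu.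
Proof.
move=> Pf mu; rewrite mcoeff_msupp -Pf mcoeff_keep_vars.
by case: ifP; rewrite ?eqxx.
Qed.

End VariableKilling.

(** * Lower bound for the Krull dimension, by going up *)

Section KrullLowerBound.
Variables (n : nat) (k : fieldType) (I : idealr {mpoly k[n]}).
Local Notation A := {ideal_quot I}.
Local Notation pi := (\pi_{ideal_quot I}%qT).
Variables (H : {fset {mpoly k[n]}}) (q D : nat).
Hypotheses (I_homog : homogeneous_ideal I) (HI : forall h, h \in H -> h \in I).
Hypothesis cover : forall f, f \is q.-homog -> ideal_gen (gens_with_vars H D) f.
Hypotheses (D_le_n : (D <= n)%N) (q_gt0 : (0 < q)%N).
(** The fixed points of [base] form the base ring [k[x_1, ..., x_D]]; on it, for [r <= D], the
    kernel of [kill r] is the ideal [(x_1, ..., x_r)]. *)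
Local Notation base := (@keep_vars n k (fun j : 'I_n => (j < D)%N)).
Local Notation kill r := (@keep_vars n k (fun j : 'I_n => (r <= j)%N)).
Hypothesis base_inj : forall b, base b = b -> b \in I -> b = 0.

(** The terms of a reduced representative are collected by tail: there are finitely many tails of
    degree below [q], and the heads make up the coefficients. *)
Lemma finite_over_base (f : {mpoly k[n]}) :
  exists beta : 'X_{1..n < q} -> {mpoly k[n]},
    (forall u, base (beta u) = beta u) /\ f - \sum_u beta u * 'X_[u] \in I.
Proof.
have [|g Ig gM] :=
    @reduces_to_bounded_tail _ _ _ _ _ _ I_homog HI cover f (msize f).
  by move=> mu /msize_mdeg_lt/ltnW.
exists (fun u : 'X_{1..n < q} =>
  \sum_(mu <- msupp g | mtail D mu == u) g@_mu *: 'X_[mhead D mu]).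
split=> [u|].
  rewrite rmorph_sum /=; apply: eq_bigr => mu _; rewrite keep_varsZ keep_varsX.
  suff -> : msupported (fun j : 'I_n => (j < D)%N) (mhead D mu) by [].
  by apply/forallP => j; rewrite mnmE; case: ifP; rewrite ?implybT.
suff <- : g = \sum_(u : 'X_{1..n < q})
   (\sum_(mu <- msupp g | mtail D mu == u) g@_mu *: 'X_[mhead D mu]) * 'X_[u] by [].
under eq_bigr do rewrite mulr_suml.
rewrite (exchange_big_dep predT) //= [LHS]mpolyE; apply: eq_big_seq => mu gmu.
have [_ muq] := gM _ gmu.
rewrite (big_pred1 (BMultinom muq)) => [|u] /=; last by rewrite eq_sym.
by rewrite -scalerAl -mpolyXD mhead_tail.
Qed.

(* Cayley-Hamilton: multiplication by [b] agrees modulo [p] with that by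
   ['X_j * f], whose matrix over the base ring vanishes when ['X_j] is killed. *)
Lemma kill_step (p : prime_idealr A) (j : 'I_n) (b f : {mpoly k[n]}) :
    (j < D)%N ->
    (forall c, base c = c -> pi c \in p -> kill j c = 0) ->
    base b = b -> pi (b - 'X_j * f) \in p ->
  kill j.+1 b = 0.
Proof.
move=> jD pP bb pbf.
have /boolp.choice[B BP] : forall s : 'X_{1..n < q},
    exists beta : 'X_{1..n < q} -> {mpoly k[n]},
    (forall u, base (beta u) = beta u) /\ f * 'X_[s] - \sum_u beta u * 'X_[u] \in I.
  by move=> s; apply: finite_over_base.
pose N := #|{: 'X_{1..n < q}}|; pose ev (i : 'I_N) : 'X_{1..n < q} := enum_val i.
pose M := \matrix_(i < N, l < N) (b *+ (i == l) - 'X_j * B (ev i) (ev l)).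
pose U := \col_(i < N) ('X_[ev i] : {mpoly k[n]}).
have MU i : pi ((M *m U) i 0) \in p.
  have -> : (M *m U) i 0 = (b - 'X_j * f) * 'X_[ev i] +
      'X_j * (f * 'X_[ev i] - \sum_u B (ev i) u * 'X_[u]).
    rewrite mxE; under eq_bigr do rewrite !mxE mulrBl.
    rewrite sumrB (bigD1 i) //= eqxx mulr1n big1 ?addr0; last first.
      by move=> l; rewrite eq_sym => /negPf->; rewrite mulr0n mul0r.
    rewrite mulrBl mulrBr addrA mulrA subrK; congr (_ - _).
    rewrite [in RHS](reindex _ (onW_bij _ (@enum_val_bij _))) mulr_sumr.
    by apply: eq_bigr => l _; rewrite mulrA.
  rewrite rmorphD rpredD // rmorphM /=; first by rewrite mulrC idealMr.
  have /eqP-> : pi (f * 'X_[ev i] - \sum_u B (ev i) u * 'X_[u]) == 0 :> A.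
    by rewrite quot_pi_eq0 (BP (ev i)).2.
  by rewrite mulr0 rpred0.
(* Since [0 < q], the monomial 1 is an entry of [U], so multiplying [M *m U] by the adjugate puts
   [\det M] itself into [p]. *)
have q0 : (mdeg (0%MM : 'X_{1..n}) < q)%N by rewrite mdeg0.
pose i0 : 'I_N := enum_rank (BMultinom q0).
have Ui0 : U i0 0 = 1 by rewrite mxE /ev enum_rankK mpolyX0.
have detp : pi (\det M) \in p.
  have -> : \det M = (\adj M *m (M *m U)) i0 0.
    by rewrite mulmxA mul_adj_mx mul_scalar_mx mxE Ui0 mulr1.
  rewrite mxE rmorph_sum rpred_sum // => l _.
  by rewrite rmorphM idealMr ?MU.
have detb : base (\det M) = \det M.
  rewrite -det_map_mx; congr (\det _); apply/matrixP => i l; rewrite !mxE.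
  by rewrite rmorphB rmorphM rmorphMn /= bb (BP _).1 keep_varsX msupported_mnm1 jD.
(* Under [kill j.+1] the matrix becomes scalar, so its determinant, known to vanish, is a power of
   [kill j.+1 b] in a domain. *)
have := congr1 (kill j.+1) (pP _ detb detp).
rewrite keep_vars_sub ?rmorph0; last by move=> m; apply: ltnW.
rewrite -det_map_mx.
have -> : map_mx (kill j.+1) M = (kill j.+1 b)%:M.
  apply/matrixP => i l; rewrite !mxE rmorphB rmorphM rmorphMn /= keep_varsX.
  by rewrite msupported_mnm1 ltnn mul0r subr0.
rewrite det_scalar => /eqP; rewrite expf_eq0 => /andP[_ /eqP]; exact.
Qed.

Definition over_killed r (p : prime_idealr A) : Prop :=
  forall b, base b = b -> pi b \in p -> kill r b = 0.

(** The images of base elements not killed by [kill r] form a multiplicative set, because [kill r]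
    maps into a domain; [prime_ideal_avoiding] applies to it. *)
Lemma prime_over_killed r (J : A -> Prop) :
    J 0 -> (forall x y, J x -> J y -> J (x + y)) ->
    (forall a x, J x -> J (a * x)) ->
    (forall b, base b = b -> J (pi b) -> kill r b = 0) ->
  exists2 p : prime_idealr A, over_killed r p & forall x, J x -> x \in p.
Proof.
move=> J0 JD JM Jr.
pose S (x : A) := exists b, [/\ base b = b, kill r b != 0 & x = pi b].
have [||x Jx [b [bb /eqP b0 xb]]|p [Jp pS]] := @prime_ideal_avoiding _ J S J0 JD JM.
- by exists 1; rewrite !rmorph1 oner_neq0.
- move=> _ _ [b [bb b0 ->]] [c [cb c0 ->]]; exists (b * c).
  by rewrite !rmorphM /= bb cb mulf_neq0.
- by apply: b0; apply: Jr; rewrite -?xb.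
exists p => // b bb pb; apply/eqP; apply: contraT => b0.
by case: (pS _ pb); exists b.
Qed.

(** The next prime is taken above the ideal [J] generated by [p r] and the class of [x_{r+1}];
    [kill_step] bounds the trace of [J] on the base ring. The chain starts from the zero ideal of
    [A] by [base_inj]. *)
Lemma going_up_chain r : (r <= D)%N -> exists p : nat -> prime_idealr A,
  (forall l, (l <= r)%N -> over_killed l (p l)) /\
  (forall j : 'I_n, (j < r)%N -> {subset p j <= p j.+1} /\ pi 'X_j \in p j.+1).
Proof.
elim: r => [_|r IHr rD].
  have [||||p p0 _] := @prime_over_killed 0%N (fun x => x = 0) => //.
  - by move=> x y -> ->; rewrite addr0.
  - by move=> a x ->; rewrite mulr0.
  - move=> b bb /eqP; rewrite quot_pi_eq0 => /(base_inj bb)->.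
    exact: rmorph0.
  by exists (fun=> p); split=> // l; rewrite leqn0 => /eqP->.
have [p [pl pj]] := IHr (ltnW rD).
have rn : (r < n)%N := leq_trans rD D_le_n; pose jr : 'I_n := Ordinal rn.
pose J x := exists z f, z \in p r /\ x = z + pi ('X_jr * f).
have [||||p' p'r Jp'] := @prime_over_killed r.+1 J.
- by exists 0, 0; rewrite rpred0 mulr0 rmorph0 addr0.
- move=> _ _ [z [f [zp ->]]] [y [g [yp ->]]]; exists (z + y), (f + g).
  by rewrite rpredD // mulrDr rmorphD addrACA.
- move=> a _ [z [f [zp ->]]]; exists (a * z), (repr a * f).
  by rewrite idealMr // mulrDr mulrCA [in RHS]rmorphM /= reprK.
- move=> b bb [z [f [zp Eb]]]; apply: (@kill_step (p r) jr b f) => //.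
    exact: pl.
  by rewrite rmorphB /= Eb addrK.
exists (fun l => if (l <= r)%N then p l else p'); split=> [l|j].
  rewrite leq_eqVlt => /predU1P[->|]; first by rewrite ltnn.
  by rewrite ltnS => lr; rewrite lr; apply: pl.
move=> j_le_r; have /predU1P[jr_eq|jr_lt] : ((j : nat) == r) || (j < r)%N.
    by rewrite -leq_eqVlt -ltnS.
  have -> : j = jr by apply: val_inj.
  rewrite /= leqnn ltnn; split=> [x xp|].
    by apply: Jp'; exists x, 0; rewrite mulr0 rmorph0 addr0.
  by apply: Jp'; exists 0, 1; rewrite rpred0 mulr1 add0r.
by rewrite /= (ltnW jr_lt) jr_lt; apply: pj.
Qed.

Lemma krull_dim_ge : exists p : 'I_D.+1 -> prime_idealr A, prime_chain p.
Proof.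
have [p [pl pj]] := going_up_chain (leqnn D).
have p_mono a b : (a <= b <= D)%N -> {subset p a <= p b}.
  move=> /andP[/subnKC<-]; elim: (b - a)%N => [_|m IHm]; first by rewrite addn0.
  rewrite addnS => mD x /(IHm (ltnW mD)).
  by have [+ _] := pj (Ordinal (leq_trans mD D_le_n)) mD; apply.
exists (fun i : 'I_D.+1 => p i) => i l il.
have lD : (l <= D)%N by rewrite -ltnS.
have iD : (i < D)%N by apply: leq_trans il lD.
pose j : 'I_n := Ordinal (leq_trans iD D_le_n).
have [_ xj] := pj j iD.
split; first by apply: p_mono; rewrite ltnW.
(* This variable enters the chain at [p i.+1]; it is not in [p i] because [kill i] leaves it
   unchanged. *)
exists (pi 'X_j); first by apply: (p_mono i.+1); rewrite ?il.
apply/negP => /(pl i (ltnW iD)); rewrite !keep_varsX !msupported_mnm1 iD leqnn.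
by move=> /(_ erefl)/eqP; rewrite -msupp_eq0 msuppX.
Qed.

End KrullLowerBound.

(** * Closure properties of generated ideals *)

Section GeneratedIdeals.
Variables (R : comNzRingType) (S : R -> Prop).

Lemma ideal_gen0 : ideal_gen S 0.
Proof. by exists [::]; rewrite big_nil. Qed.

Lemma ideal_genD f g : ideal_gen S f -> ideal_gen S g -> ideal_gen S (f + g).
Proof.
move=> [s [sS ->]] [t [tS ->]]; exists (s ++ t); rewrite big_cat; split=> // ag.
by rewrite mem_cat => /orP[/sS|/tS].
Qed.

Lemma ideal_genMl a f : ideal_gen S f -> ideal_gen S (a * f).
Proof.
move=> [s [sS ->]]; exists [seq (a * ag.1, ag.2) | ag <- s]; split.
  by move=> ag /mapP[bh /sS Sbh ->].
by rewrite mulr_sumr big_map; apply: eq_bigr => ag _; rewrite mulrA.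
Qed.

Lemma ideal_gen_mem f : S f -> ideal_gen S f.
Proof.
move=> Sf; exists [:: (1, f)]; rewrite big_seq1 mul1r; split=> // ag.
by rewrite mem_seq1 => /eqP->.
Qed.

End GeneratedIdeals.

(** * From leading exponents to the covering condition *)

Section PommaretBasis.
Variables (k : fieldType) (n : nat) (I : idealr {mpoly k[n]}).
Variables (le : rel 'X_{1..n}) (H : {fset {mpoly k[n]}}).
Hypotheses (I_neq0 : exists2 f, f \in I & f != 0) (le_order : term_order le).
Hypotheses (H_basis : pommaret_basis le I H) (H_homog : homogeneous_set H).
Local Notation q := (fset_degree H).

Lemma mdegree_le h : h \in H -> (mdegree h <= q)%N.
Proof. by move=> Hh; apply: leq_bigmax_seq. Qed.

(** In degree 0 a basis element would be a non-zero constant, hence a unit in the proper ideal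
    [I]. *)
Lemma fset_degree_gt0 : (0 < q)%N.
Proof.
case: H_basis => HI _ cones _; rewrite lt0n; apply/negP => /eqP q0.
have [f If f0] := I_neq0.
have [h Hh _] : exists2 h, h \in H & pommaret_cone (lexp le h) (lexp le f).
  by apply/cones; exists f.
have [Ih h0] := HI _ Hh.
have := mdegree_le Hh.
rewrite q0 leqn0 /mdegree -subn1 subn_eq0 => /msize1_polyC hC.
move: Ih h0; rewrite hC -quot_pi_eq0 => /eqP/quot_const_eq0->.
by rewrite mpolyC0 eqxx.
Qed.

Lemma mdeg_lexp_le h : h \in H -> (mdeg (lexp le h) <= q)%N.
Proof.
case: H_basis => HI _ _ _ Hh; have [_ h0] := HI _ Hh.
have [/msize_mdeg_lt hl _] := lexpP le_order h0.
apply: leq_trans (mdegree_le Hh).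
by rewrite /mdegree -ltnS (leq_trans hl) // leqSpred.
Qed.

Lemma lexpX mu : lexp le ('X_[mu] : {mpoly k[n]}) = mu.
Proof.
case: (le_order) => le_total _ _ _ _.
apply: lexp_unique => // [|nu]; rewrite msuppX mem_seq1 // => /eqP->.
by have := le_total mu mu; rewrite orbb.
Qed.

(** By [homog_span] each monomial of degree [q] need only be the leading exponent of a homogeneous
    element of the generated ideal: itself if one of the first [i] variables divides it, otherwise a
    monomial multiple of a basis element. *)
Lemma cover_of_monomials i :
    (forall mu, mdeg mu = q -> (forall j : 'I_n, (j < i)%N -> mu j = 0%N) ->
       exists f, [/\ f \in I, f != 0 & mu = lexp le f]) ->
  forall f, f \is q.-homog -> ideal_gen (gens_with_vars H i) f.
Proof.
case: (H_basis) => HI _ cones _ mon f fq; move: f fq.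
apply: (homog_span le_order).
- exact: ideal_gen0.
- exact: ideal_genD.
- by move=> a f; rewrite -mul_mpolyC; apply: ideal_genMl.
move=> mu muq.
have [[j ji muj]|no_j] := pselect (exists2 j : 'I_n, (j < i)%N & mu j != 0%N).
  exists 'X_[mu]; split.
  - have jmu : (U_(j) <= mu)%MM by rewrite lep1mP.
    rewrite -(submK jmu) mpolyXD; apply/ideal_genMl/ideal_gen_mem.
    by right; exists j.
  - by rewrite -msupp_eq0 msuppX.
  - by rewrite dhomogX; apply/eqP.
  - exact: lexpX.
have /cones[h Hh [rho _ Emu]] : exists f, [/\ f \in I, f != 0 & mu = lexp le f].
  apply: mon => // j ji; apply/eqP; apply: contrapT => /negP muj.
  by apply: no_j; exists j.
have [_ h0] := HI _ Hh; have [hl _] := lexpP le_order h0.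
exists (h * 'X_[rho]); split.
- by rewrite mulrC; apply/ideal_genMl/ideal_gen_mem; left.
- by rewrite mulf_neq0 // -msupp_eq0 msuppX.
- have [e he] := homogP _ _ (H_homog Hh).
  rewrite -muq Emu mdegD (dhomog_mf he hl) dhomogM // dhomogX.
  by apply/eqP.
- by rewrite lexpMX // -Emu.
Qed.

(** The leading exponent of [f] involves only [x_1, ..., x_{d+1}], so [pommaret_monomial_mem] yields
    all monomials of degree [q] in [x_{d+1}, ..., x_n]. For [D = d.+1] this contradicts
    minimality. *)
Lemma cover_pred d f : f \in I -> f != 0 ->
    keep_vars (fun j : 'I_n => (j < d.+1)%N) f = f ->
  forall g, g \is q.-homog -> ideal_gen (gens_with_vars H d) g.
Proof.
move=> If f0 fd; apply: cover_of_monomials => mu muq mud.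
case: (H_basis) => HI _ cones _.
pose N mu := exists f, [/\ f \in I, f != 0 & mu = lexp le f].
pose E ga := exists2 h, h \in H & ga = lexp le h.
have [fl _] := lexpP le_order f0.
apply: (@pommaret_monomial_mem n N E q d (lexp le f)) => //.
- move=> _ rho [g [Ig g0 ->]]; exists (g * 'X_[rho]); split.
  + by rewrite mulrC idealMr.
  + by rewrite mulf_neq0 // -msupp_eq0 msuppX.
  + by rewrite lexpMX.
- move=> nu; split=> [/cones[h Hh cn]|[ga [h Hh ->] cn]].
    by exists (lexp le h) => //; exists h.
  by apply/cones; exists h.
- by move=> _ [h Hh ->]; apply: mdeg_lexp_le.
- by exists f.
- move=> j dj; apply/eqP; apply: contraTT dj => flj.
  have /forallP/(_ j)/implyP/(_ flj) := keep_vars_idP fd fl.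
  by rewrite ltnS -leqNgt.
- exact: fset_degree_gt0.
Qed.

End PommaretBasis.

Theorem proposition3p14 (k : fieldType) (n : nat)
    (I : idealr {mpoly k[n]})
    (I_neq0 : exists2 f, f \in I & f != 0)
    (I_homog : homogeneous_ideal I)
    (le : rel 'X_{1..n}) (le_order : term_order le)
    (H : {fset {mpoly k[n]}})
    (H_basis : pommaret_basis le I H) (H_homog : homogeneous_set H)
    (q : nat) (q_def : q = fset_degree H) :
  exists D : nat,
    is_krull_dim {ideal_quot I} D /\
    is_minimum (fun i => (i <= n)%N /\
      forall f : {mpoly k[n]},
        hcomponent (ideal_gen (gens_with_vars H i)) q f <-> f \is q.-homog) D.
Proof.
have HI h : h \in H -> h \in I by case: H_basis => + _ _ _ => /[apply] -[].
have q0 : (0 < q)%N by rewrite q_def; apply: fset_degree_gt0 H_basis.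
pose cover i := forall f, f \is q.-homog -> ideal_gen (gens_with_vars H i) f.
have coverE i : (forall f : {mpoly k[n]},
      hcomponent (ideal_gen (gens_with_vars H i)) q f
    <-> f \is q.-homog) <-> cover i.
  split=> [E f /E[]//|C f]; split=> [[]//|fq]; split=> //; exact: C.
have ex_cover : exists i, `[< (i <= n)%N /\ cover i >].
  (* For [i = n] no monomial of positive degree avoids the first [i] variables. *)
  exists n; apply/asboolP; split=> //; rewrite /cover q_def.
  apply: (cover_of_monomials le_order H_basis H_homog) => mu muq mu0.
  move: q0; rewrite q_def -muq mdegE big1 // => j _; exact: mu0.
case: (ex_minnP ex_cover) => D /asboolP[Dn coverD] Dmin.
exists D; split; last first.
  split; first by split=> //; apply/coverE.
  by move=> i [i_n /coverE Ci]; apply: Dmin; apply/asboolP.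
split; last by move=> e p; apply: (krull_dim_le I_homog HI coverD Dn).
apply: (krull_dim_ge I_homog HI coverD Dn q0) => b bb Ib.
apply/eqP; apply: contraT => b0.
case: D Dn coverD Dmin bb => [_ _ _|d dn _ Dmin] bb.
  (* For [D = 0] the base ring consists of the constants, and the proper ideal [I] contains no
     non-zero constant. *)
  have bC : b = (b@_(0%MM))%:MP.
    apply/mpolyP => nu; rewrite mcoeffC; case: eqVneq => [->|nu0].
      by rewrite mulr1.
    rewrite mulr0; apply/memN_msupp_eq0; apply: contra nu0 => bnu.
    apply/eqP/mnmP => j; rewrite mnm0E; apply/eqP; apply: contraT => nuj.
    by have /forallP/(_ j)/implyP/(_ nuj) := keep_vars_idP bb bnu.
  move: Ib b0; rewrite bC -quot_pi_eq0 => /eqP/quot_const_eq0->.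
  by rewrite mpolyC0 eqxx.
suff : (d.+1 <= d)%N by rewrite ltnn.
apply: Dmin; apply/asboolP; split; first exact: ltnW.
rewrite /cover q_def; apply: (cover_pred I_neq0 le_order H_basis H_homog Ib b0 bb).
Qed.
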